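(* Suppose that for any $(\theta,x)\in\Theta\times\mathcal X$, $\mathfrak C$ is continuously differentiable in $z$, and that $\mathcal Z$ is a closed convex subset of $\mathbb R^{d_z}$. Suppose there exist a constant $\beta$ and a compact set $\mathcal Z_\beta\subset\mathcal Z$ such that the lower level set $\{z\in\mathcal Z:\mathfrak C(z,\theta,x)\le\beta\}$ is nonempty and contained in $\mathcal Z_\beta$ for all $(\theta,x)\in\Theta\times\mathcal X$. Then for $\bar\theta\in\Theta$ and $x\in\mathcal X$: (i) $\mathfrak C^*(\theta,x)$ is locally Lipschitz (in $\theta$) around $\bar\theta$, its Clarke subdifferential satisfies $$\partial_\theta\mathfrak C^*(\bar\theta,x)=\mathrm{co}\{\nabla_\theta\mathfrak C(z,\bar\theta,x):z\in\mathcal Z^*(\bar\theta,x)\},$$ and its directional derivative is given by $$D_\theta\mathfrak C^*(\bar\theta,x;d)=\min_{z\in\mathcal Z^*(\bar\theta,x)}\langle\nabla_\theta\mathfrak C(z,\bar\theta,x),d\rangle,\quad\forall d\in\mathbb R^{d_\theta}.$$ (ii) For any vector $w\in\partial_\theta\mathfrak C^*(\bar\theta,x)\subset\mathbb R^{d_\theta}$, there exist points $z_1,\dots,z_{d_\theta+1}\in\mathcal Z^*(\bar\theta,x)$ and $\lambda_1,\dots,\lambda_{d_\theta+1}\ge0$ with $\sum_{i=1}^{d_\theta+1}\lambda_i=1$ such that $$w=\sum_{i=1}^{d_\theta+1}\lambda_i\nabla_\theta\mathfrak C(z_i,\bar\theta,x).$$ (iii) For each $x\in\mathcal X$, $\mathbb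 E_P[L_{\mu(x)}(z,X,Y,\theta)\mid X=x]$ is locally Lipschitz continuous (in $\theta$) around $\bar\theta$.
   Context: Setting: $X,Y$ are random vectors with values in $\mathbb R^{d_x},\mathbb R^{d_y}$, support sets $\mathcal X,\mathcal Y$ and joint law $P$. $\Theta\subset\mathbb R^{d_\theta}$; $L:\mathbb R^{d_z}\times\mathbb R^{d_x}\times\mathbb R^{d_y}\times\mathbb R^{d_\theta}\to\mathbb R$ and $c:\mathbb R^{d_z}\times\mathbb R^{d_y}\to\mathbb R$ are continuous; $f_\theta(x)$ is a probability distribution of $Y$; $\mathfrak C(z,\theta,x):=\mathbb E_{f_\theta(x)}[c(z,Y)]$. $\mathfrak C^*(\theta,x):=\min_{z\in\mathcal Z}\mathfrak C(z,\theta,x)$ and $\mathcal Z^*(\theta,x):=\arg\min_{z\in\mathcal Z}\mathfrak C(z,\theta,x)$. $\mu:\mathcal X\to\mathbb R_+$ is a measurable function and $$L_{\mu(x)}(z,x,y,\theta):=L(z,x,y,\theta)+\mu(x)\big(\mathfrak C(z,\theta,x)-\mathfrak C^*(\theta,x)\big).$$ $\nabla_\theta\mathfrak C$ denotes the gradient of $\mathfrak C$ in $\theta$ (its existence is implicit in the statement); $\partial_\theta$ is the Clarke subdifferential in $\theta$; co is the convex hull.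
   Formalization: Added: θ̄ lies in the interior of Θ; C is differentiable in θ with ∇_θC jointly continuous in (z,θ) on Z × int Θ; in (iii), z∈Z, and L is integrable at θ̄ and Lipschitz in θ near θ̄ with an integrable modulus, under the conditional law of Y given X=x. *)

(* Defs.v *)
From HB Require Import structures.
From mathcomp Require Import all_boot all_order all_algebra.
From mathcomp Require Import all_classical all_reals all_analysis.

Set Implicit Arguments.
Unset Strict Implicit.
Unset Printing Implicit Defensive.

Import Order.TTheory GRing.Theory Num.Theory.
Import numFieldNormedType.Exports.

Local Open Scope classical_set_scope.
Local Open Scope ring_scope.

Section Euclidean.
Context {R : realType}.

Definition dotprod n (u v : 'rV[R]_n) : R := \sum_(i < n) u 0 i * v 0 i.

Definition gradient n (g : 'rV[R]_n -> R) (a : 'rV[R]_n) : 'rV[R]_n :=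
  \row_(j < n) 'D_(delta_mx 0 j) g a.

Definition continuously_differentiable n (g : 'rV[R]_n -> R) : Prop :=
  (forall a, differentiable g a) /\ continuous (gradient g).

Definition convex_hull n (A : set 'rV[R]_n) : set 'rV[R]_n :=
  smallest (@convex_set R 'rV[R]_n) A.

Definition is_minimum (A : set R) (m : R) : Prop := A m /\ lbound A m.

(* The norm of 'rV[R]_n is the sup norm; up to the constant this is the same
   notion as with the Euclidean norm. *)
Definition locally_lipschitz_around n (g : 'rV[R]_n -> R) (a : 'rV[R]_n) : Prop :=
  exists2 U, nbhs a U & [lipschitz g t | t in U].

Definition is_dirderiv n (g : 'rV[R]_n -> R) (a d : 'rV[R]_n) (l : R) : Prop :=
  (g (a + s *: d) - g a) / s @[s --> 0^'+] --> l.

(* Clarke's generalized directional derivative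
   limsup_(b -> a, s -> 0+) (g (b + s d) - g b) / s. *)
Definition clarke_dirderiv n (g : 'rV[R]_n -> R) (a d : 'rV[R]_n) : \bar R :=
  limf_esup (fun p : 'rV[R]_n * R => ((g (p.1 + p.2 *: d) - g p.1) / p.2)%:E)
            (filter_prod (nbhs a) (0 : R)^'+).

Definition clarke_subdiff n (g : 'rV[R]_n -> R) (a : 'rV[R]_n) : set 'rV[R]_n :=
  [set w | forall d, ((dotprod w d)%:E <= clarke_dirderiv g a d)%E].

End Euclidean.

(* R^n with its Borel sigma-algebra. *)
Notation borel_rV R n := (g_sigma_algebraType (@open 'rV[R]_n)).

Section Probability.
Context {R : realType}.

Definition law_support n (nu : set 'rV[R]_n -> \bar R) : set 'rV[R]_n :=
  [set x | forall U, open U -> U x -> (0 < nu U)%E].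

(* kappa x is a version of the conditional law of Y given X = x. *)
Definition is_conditional_law d (Omega : measurableType d)
    (Pr : probability Omega R) (dx dy : nat)
    (X : {RV Pr >-> borel_rV R dx}) (Y : {RV Pr >-> borel_rV R dy})
    (kappa : R.-pker (borel_rV R dx) ~> (borel_rV R dy)) : Prop :=
  forall (A : set (borel_rV R dx)) (B : set (borel_rV R dy)),
    measurable A -> measurable B ->
    Pr (X @^-1` A `&` Y @^-1` B) = (\int[distribution Pr X]_(x in A) kappa x B)%E.

(* E[g(X, Y) | X = x], computed with the version kappa. *)
Definition conditional_expectation (dx dy : nat)
    (kappa : R.-pker (borel_rV R dx) ~> (borel_rV R dy))
    (g : 'rV[R]_dx -> 'rV[R]_dy -> R) (x : 'rV[R]_dx) : R :=
  \int[kappa x]_y g x y.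

(* l(y, .) is Lipschitz near a, on one neighborhood of a for almost every y,
   with an integrable Lipschitz modulus. *)
Definition integrably_lipschitz_around (dy dt : nat)
    (nu : {measure set (borel_rV R dy) -> \bar R})
    (l : 'rV[R]_dy -> 'rV[R]_dt -> R) (a : 'rV[R]_dt) : Prop :=
  exists (U : set 'rV[R]_dt) (k : 'rV[R]_dy -> R),
    [/\ nbhs a U,
        nu.-integrable setT (fun y : borel_rV R dy => (k y)%:E) &
        {ae nu, forall y : borel_rV R dy, forall t1 t2, U t1 -> U t2 ->
           `|l y t1 - l y t2| <= k y * `|t1 - t2|}].

End Probability.

Section Model.
Context {R : realType} {dx dy dz dt : nat}.
Variables (c : 'rV[R]_dz -> 'rV[R]_dy -> R)
  (f : 'rV[R]_dt -> 'rV[R]_dx -> probability (borel_rV R dy) R)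
  (Z : set 'rV[R]_dz).

Definition expected_cost (z : 'rV[R]_dz) (t : 'rV[R]_dt) (x : 'rV[R]_dx) : R :=
  \int[f t x]_y c z y.

(* inf over Z; it is the minimum as soon as argmin_cost is nonempty. *)
Definition optimal_cost (t : 'rV[R]_dt) (x : 'rV[R]_dx) : R :=
  inf [set expected_cost z t x | z in Z].

Definition argmin_cost (t : 'rV[R]_dt) (x : 'rV[R]_dx) : set 'rV[R]_dz :=
  [set z | Z z /\ forall z', Z z' -> expected_cost z t x <= expected_cost z' t x].

Definition grad_cost (z : 'rV[R]_dz) (t : 'rV[R]_dt) (x : 'rV[R]_dx) : 'rV[R]_dt :=
  gradient (fun t' => expected_cost z t' x) t.

Definition penalized_loss
    (L : 'rV[R]_dz -> 'rV[R]_dx -> 'rV[R]_dy -> 'rV[R]_dt -> R)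
    (m : R) (z : 'rV[R]_dz) (x : 'rV[R]_dx) (y : 'rV[R]_dy) (t : 'rV[R]_dt) : R :=
  L z x y t + m * (expected_cost z t x - optimal_cost t x).

End Model.

(* Main.v *)
(* Near [tbar] the optimal cost is the minimum of [C(z, t)] over the fixed compact
   set [Zbeta], so this is Danskin's theorem for a compact family of functions
   whose gradients in [t] are jointly continuous.  The mean value theorem along
   segments bounds each difference quotient of the value function, from above by
   <grad C(z, t), d> with [z] a minimizer at the starting point and [t] on the
   segment.  By compactness, for a starting point and [t] near [tbar], this is at
   most the maximum over the minimizers at [tbar], up to an epsilon.  Hence the
   directional derivatives and the formula
   C*°(tbar; d) = max <grad C(z, tbar), d>; the convex hull of the gradients is
   compact by Caratheodory's theorem, and separating a point from it turns the
   formula for C*° into the one for the subdifferential. *)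
Require Import Defs.
From HB Require Import structures.
From mathcomp Require Import all_boot all_order all_algebra.
From mathcomp Require Import all_classical all_reals all_analysis.
From mathcomp Require Import measurable_realfun ring lra.

Set Implicit Arguments.
Unset Strict Implicit.
Unset Printing Implicit Defensive.

Import Order.TTheory GRing.Theory Num.Theory.
Import numFieldNormedType.Exports.

Local Open Scope classical_set_scope.
Local Open Scope ring_scope.

(** * Convex combinations, Caratheodory's theorem and compactness of convex hulls *)

Section ConvexCombinations.
Context {R : realType} {n : nat}.
Implicit Types (A C : set 'rV[R]_n).

Lemma lmod_convE (x y : 'rV[R]_n) (l : {i01 R}) :
  conv l (x : convex_lmodType _) y = l%:num *: x + (1 - l%:num) *: y.
Proof. by []. Qed.

Definition convex_combinations k A : set 'rV[R]_n :=
  [set w | exists (lam : 'I_k -> R) (v : 'I_k -> 'rV[R]_n),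
    [/\ forall i, 0 <= lam i, \sum_i lam i = 1, forall i, A (v i) &
        w = \sum_i lam i *: v i]].

(** Append a coordinate 1 to each of the [k.+1] vectors: they now live in dimension [n + 1 < k.+1],
    so the left kernel of their matrix contains a nonzero row. *)
Lemma affinely_dependent k (v : 'I_k.+1 -> 'rV[R]_n) : (n < k)%N ->
  exists mu : 'I_k.+1 -> R, [/\ exists i, 0 < mu i, \sum_i mu i = 0 &
    \sum_i mu i *: v i = 0].
Proof.
move=> nk.
pose M : 'M[R]_(k.+1, n + 1) := row_mx (\matrix_i v i) (const_mx 1).
have : kermx M != 0.
  rewrite kermx_eq0 /row_free neq_ltn; apply/orP; left.
  by rewrite (leq_ltn_trans (rank_leq_col _)) // addn1 ltnS.
case/rowV0Pn => u /sub_kermxP uM u0.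
move: uM; rewrite mul_mx_row -row_mx0 => /eq_row_mx[uV u1].
have sum_u : \sum_i u 0 i = 0.
  have /matrixP/(_ 0 0) := u1; rewrite mxE [RHS]mxE => u10.
  by apply: etrans u10; apply: eq_bigr => i _; rewrite mxE mulr1.
have sum_uv : \sum_i u 0 i *: v i = 0.
  by apply: etrans uV; rewrite mulmx_sum_row; apply: eq_bigr => i _; rewrite rowK.
exists (u 0); split => //.
(* Without a positive entry, all entries are nonpositive with sum zero, hence zero, against
   [u != 0]. *)
apply: contrapT => /forallNP u_le0; move/negP: u0; apply; apply/eqP/rowP => i.
have {}u_le0 j : u 0 j <= 0 by rewrite leNgt; apply/negP/u_le0.
have sumN : \sum_j - u 0 j = 0 by rewrite sumrN sum_u oppr0.
have u_ge0 j : true -> 0 <= - u 0 j by rewrite oppr_ge0.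
have /eqP : - u 0 i = 0 by exact: (psumr_eq0P u_ge0 sumN).
by rewrite oppr_eq0 mxE => /eqP.
Qed.

(** Caratheodory's reduction: subtracting [q] times an affine dependence [mu] keeps both the point
    and the total weight. With [q] the least ratio [lam i / mu i] over [0 < mu i], the weights stay
    nonnegative and the one at [i0] vanishes. *)
Lemma convex_combinations_drop k A : (n < k)%N ->
  convex_combinations k.+1 A `<=` convex_combinations k A.
Proof.
move=> nk w [lam [v [lam0 lam1 Av ->]]].
have [mu [[i1 mu_i1] mu0 muv]] := affinely_dependent v nk.
case: (@arg_minP _ _ _ i1 (fun i => 0 < mu i) (fun i => lam i / mu i) mu_i1).
move=> i0 mu_i0 i0_min; set q := lam i0 / mu i0 in i0_min.
have q0 : 0 <= q by rewrite divr_ge0// ltW.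
pose lam' i := lam i - q * mu i.
have lam'0 i : 0 <= lam' i.
  rewrite subr_ge0; have [mi|mi] := ltP 0 (mu i).
    by rewrite -ler_pdivlMr//; exact: i0_min.
  by rewrite (le_trans _ (lam0 i))// mulr_ge0_le0.
have lam'i0 : lam' i0 = 0 by rewrite /lam' /q divfK ?subrr// gt_eqF.
have lam'E i : lam' i = lam i - q * mu i by [].
clearbody lam'.
exists (fun j => lam' (lift i0 j)), (fun j => v (lift i0 j)); split => //.
  have <- : \sum_i lam' i = 1.
    under eq_bigr do rewrite lam'E.
    by rewrite sumrB lam1 -mulr_sumr mu0 mulr0 subr0.
  by rewrite (bigD1_ord i0)//= lam'i0 add0r.
have -> : \sum_i lam i *: v i = \sum_i lam' i *: v i.
  under [RHS]eq_bigr do rewrite lam'E scalerBl -scalerA.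
  by rewrite sumrB -scaler_sumr muv scaler0 subr0.
by rewrite (bigD1_ord i0)//= lam'i0 scale0r add0r.
Qed.

Lemma convex_combinations_caratheodory k A :
  convex_combinations (n.+1 + k) A `<=` convex_combinations n.+1 A.
Proof.
elim: k => [|k IH]; first by rewrite addn0.
rewrite addnS; apply: subset_trans IH; apply: convex_combinations_drop.
by rewrite addSn ltnS leq_addr.
Qed.

(** Induction on the number of points: the first one is split off and the others are rescaled by
    their total weight [s]; when [s = 0] only the first point remains. *)
Lemma convex_combinations_sub k A C : convex_set (C : set (convex_lmodType _)) ->
  A `<=` C -> convex_combinations k A `<=` C.
Proof.
move=> cC AC; elim: k => [|k IH] w [lam [v [lam0 lam1 Av ->]]].
  by move: lam1; rewrite big_ord0 => /esym/eqP; rewrite oner_eq0.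
move: lam1; rewrite !big_ord_recl => lam1.
set s := \sum_(i < k) lam (lift ord0 i) in lam1.
have s0 : 0 <= s by apply: sumr_ge0.
have {}lam1 : s = 1 - lam ord0 by rewrite -lam1 addrAC subrr add0r.
have [se|sne] := eqVneq s 0.
  have lam_lift i : lam (lift ord0 i) = 0 by apply: (psumr_eq0P _ se).
  rewrite big1 => [|i _]; last by rewrite lam_lift scale0r.
  have -> : lam ord0 = 1 by lra.
  by rewrite scale1r addr0; exact: AC.
have Crest : C (\sum_(i < k) (lam (lift ord0 i) / s) *: v (lift ord0 i)).
  apply: IH; exists (fun i => lam (lift ord0 i) / s), (fun i => v (lift ord0 i)).
  by split => // [i|]; [rewrite divr_ge0|rewrite -mulr_suml divff].
have l01 : 0 <= lam ord0 <= 1.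
  by rewrite lam0/= -subr_ge0 -lam1.
have := cC _ _ (Itv01 (andP l01).1 (andP l01).2) (mem_set (AC _ (Av ord0)))
  (mem_set Crest).
rewrite inE lmod_convE/=; congr C; congr (_ + _).
rewrite -lam1 scaler_sumr; apply: eq_bigr => i _.
by rewrite scalerA mulrC divfK.
Qed.

(** Mixing two combinations concatenates them into one of [n.+1 + n.+1] points, which Caratheodory's
    reduction brings back to [n.+1]. *)
Lemma convex_combinations_convex A :
  convex_set (convex_combinations n.+1 A : set (convex_lmodType _)).
Proof.
move=> x y l /[!inE] -[lx [vx [lx0 lx1 Ax ->]]] [ly [vy [ly0 ly1 Ay ->]]].
rewrite lmod_convE.
apply: (@convex_combinations_caratheodory n.+1).
exists (fun i => match fintype.split i with
                 | inl j => l%:num * lx j | inr j => (1 - l%:num) * ly j end).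
exists (fun i => match fintype.split i with inl j => vx j | inr j => vy j end).
have sl j : fintype.split (lshift n.+1 j : 'I_(n.+1 + n.+1)) = inl j.
  exact: (unsplitK (inl _)).
have sr j : fintype.split (rshift n.+1 j : 'I_(n.+1 + n.+1)) = inr j.
  exact: (unsplitK (inr _)).
split.
- by move=> i; case: (fintype.split i) => j; rewrite mulr_ge0// subr_ge0.
- rewrite big_split_ord/=.
  under eq_bigr do rewrite sl.
  under [X in _ + X]eq_bigr do rewrite sr.
  by rewrite -!mulr_sumr lx1 ly1 !mulr1 addrC subrK.
- by move=> i; case: (fintype.split i).
- rewrite big_split_ord/=.
  under [in RHS]eq_bigr do rewrite sl -scalerA.
  under [X in _ = _ + X]eq_bigr do rewrite sr -scalerA.
  by rewrite -!scaler_sumr.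
Qed.

(** The fixed number [n.+1] of points is what makes the hull a continuous image of a compact set,
    and it is the number of points asked for in (ii). *)
Lemma convex_hullE A : convex_hull A = convex_combinations n.+1 A.
Proof.
rewrite eqEsubset; split.
  apply: smallest_sub; first exact: convex_combinations_convex.
  move=> a Aa; exists (fun i => (i == ord0)%:R), (fun=> a); split => //.
  - by rewrite (bigD1 ord0)//= big1 ?addr0// => i /negPf ->.
  - by rewrite -scaler_suml (bigD1 ord0)//= big1 ?addr0 ?scale1r// => i /negPf ->.
move=> w Aw C [cC AC]; exact: convex_combinations_sub Aw.
Qed.

Lemma convex_hull_compact A : compact A -> compact (convex_hull A).
Proof.
move=> cA; rewrite convex_hullE.
(* Families of weights and of points carry the topology of pointwise convergence, so that
   Tychonoff's theorem makes [K] compact; the simplex condition [S] then cuts out a closed part. *)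
pose T : topologicalType := ({ptws 'I_n.+1 -> R} * {ptws 'I_n.+1 -> 'rV[R]_n})%type.
pose K : set T := [set lam | forall i, `[0, 1]%classic (lam i)] `*`
                  [set v | forall i, A (v i)].
have cK : compact K.
  apply: compact_setX.
    apply: (@tychonoff _ (fun=> R) (fun=> `[0, 1]%classic)) => i.
    exact: segment_compact.
  by apply: (@tychonoff _ (fun=> 'rV[R]_n) (fun=> A)).
have cl i : continuous (fun p : T => p.1 i).
  move=> p; apply: (cvg_comp fst (fun f : {ptws 'I_n.+1 -> R} => f i) cvg_fst).
  exact: (@proj_continuous _ (fun=> R) i).
have cv i : continuous (fun p : T => p.2 i).
  move=> p; apply: (cvg_comp snd (fun f : {ptws 'I_n.+1 -> 'rV[R]_n} => f i) cvg_snd).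
  exact: (@proj_continuous _ (fun=> 'rV[R]_n) i).
have csum : continuous (fun p : T => \sum_i p.1 i).
  have add_cont : continuous (fun p : R * R => p.1 + p.2) by exact: add_continuous.
  by apply: (continuous_big (P := predT) add_cont) => i _; exact: cl.
have ccomb : continuous (fun p : T => \sum_i p.1 i *: p.2 i).
  have add_cont : continuous (fun p : 'rV[R]_n * 'rV[R]_n => p.1 + p.2).
    exact: add_continuous.
  apply: (continuous_big (P := predT) add_cont) => i _ p.
  have lp : (fun q : T => q.1 i) @ p --> p.1 i by exact: cl.
  have vp : (fun q : T => q.2 i) @ p --> p.2 i by exact: cv.
  exact: (cvgZ lp vp).
pose S : set T := [set p | \sum_i p.1 i = 1].
have cS : closed S.
  apply: (@preimage_closed _ _ (fun p : T => \sum_i p.1 i) [set 1]).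
    by move=> p _; exact: csum.
  exact: closed_eq.
have cKS : compact (K `&` S) by apply: compact_closedI.
rewrite (_ : convex_combinations _ _ =
  (fun p : T => \sum_i p.1 i *: p.2 i) @` (K `&` S)); last first.
  rewrite eqEsubset; split => [w [lam [v [l0 l1 Av ->]]]|w [[lam v] [[/= l01 Av] Sl] <-]].
    exists (lam, v) => //; split => //; split => //= i.
    rewrite in_itv/= l0/= -l1 (bigD1 i)//= lerDl sumr_ge0//.
  exists lam, v; split => // i.
  by have := l01 i; rewrite /= in_itv/= => /andP[].
apply: continuous_compact => //; exact: continuous_subspaceT.
Qed.

End ConvexCombinations.

(** * The dot product, its relation to the sup norm, and strict separation *)

Section DotProduct.
Context {R : realType} {n : nat}.
Implicit Types u v w d : 'rV[R]_n.

Lemma dotprodC u v : dotprod u v = dotprod v u.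
Proof. by apply: eq_bigr => i _; rewrite mulrC. Qed.

Lemma dotprodDl u v w : dotprod (u + v) w = dotprod u w + dotprod v w.
Proof. by rewrite -big_split; apply: eq_bigr => i _; rewrite mxE mulrDl. Qed.

Lemma dotprodZl (a : R) u w : dotprod (a *: u) w = a * dotprod u w.
Proof. by rewrite mulr_sumr; apply: eq_bigr => i _; rewrite mxE mulrA. Qed.

Lemma dotprodNl u w : dotprod (- u) w = - dotprod u w.
Proof. by rewrite -scaleN1r dotprodZl mulN1r. Qed.

Lemma dotprodBl u v w : dotprod (u - v) w = dotprod u w - dotprod v w.
Proof. by rewrite dotprodDl dotprodNl. Qed.

Lemma dotprodBr u v w : dotprod u (v - w) = dotprod u v - dotprod u w.
Proof. by rewrite dotprodC dotprodBl !(dotprodC u). Qed.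

Lemma dotprodNr u w : dotprod u (- w) = - dotprod u w.
Proof. by rewrite dotprodC dotprodNl dotprodC. Qed.

Lemma dotprodZr (a : R) u w : dotprod u (a *: w) = a * dotprod u w.
Proof. by rewrite dotprodC dotprodZl dotprodC. Qed.

Lemma dotprod_gt0 u : u != 0 -> 0 < dotprod u u.
Proof.
move=> u0; rewrite lt_neqAle eq_sym sumr_ge0 ?andbT; last first.
  by move=> i _; rewrite -expr2 sqr_ge0.
apply: contra u0 => /eqP uu0; apply/eqP/rowP => i; rewrite mxE.
have u_ge0 j : true -> 0 <= u 0 j * u 0 j by rewrite -expr2 sqr_ge0.
have /eqP : u 0 i * u 0 i = 0 by exact: (psumr_eq0P u_ge0 uu0).
by rewrite mulf_eq0 orbb => /eqP.
Qed.

Lemma coord_le_norm u i : `|u 0 i| <= `|u|.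
Proof.
rewrite [leRHS]/Num.Def.normr/= mx_normrE; apply/bigmax_geP; right.
by exists (0, i).
Qed.

(** The factor [n] comes from the sup norm: each of the [n] coordinate products is at most the
    product of the norms. *)
Lemma dotprod_le_norm u v : `|dotprod u v| <= n%:R * `|u| * `|v|.
Proof.
rewrite (le_trans (ler_norm_sum _ _ _))//.
have -> : n%:R * `|u| * `|v| = \sum_(i < n) `|u| * `|v|.
  by rewrite sumr_const card_ord -mulrA mulr_natl.
apply: ler_sum => i _; rewrite normrM; by apply: ler_pM => //; exact: coord_le_norm.
Qed.

Lemma continuous_dotprod (T : topologicalType) (f g : T -> 'rV[R]_n) :
  continuous f -> continuous g -> continuous (fun x => dotprod (f x) (g x)).
Proof.
move=> cf cg.
have add_cont : continuous (fun p : R * R => p.1 + p.2) by exact: add_continuous.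
apply: (continuous_big (P := predT) add_cont) => i _ p.
have fi : (fun q => f q 0 i) @ p --> f p 0 i.
  exact: (continuous_comp (cf p) (@coord_continuous _ _ _ 0 i (f p))).
have gi : (fun q => g q 0 i) @ p --> g p 0 i.
  exact: (continuous_comp (cg p) (@coord_continuous _ _ _ 0 i (g p))).
exact: (cvgM fi gi).
Qed.

Lemma continuous_dotprodl d : continuous (fun u => dotprod u d).
Proof.
apply: (@continuous_dotprod _ id (cst d)); first by move=> ?; exact: cvg_id.
exact: cst_continuous.
Qed.

(* [p] minimizes the Euclidean distance to [w] over [C], and [d := w - p]. *)
Lemma strict_separation (C : set 'rV[R]_n) w :
  convex_set (C : set (convex_lmodType _)) -> compact C -> C !=set0 -> ~ C w ->
  exists d, forall v, C v -> dotprod v d < dotprod w d.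
Proof.
move=> convC cC C0 Cw.
have cf : continuous (fun v => dotprod (w - v) (w - v)).
  have cB : continuous (fun v => w - v).
    move=> v; apply: (@cvgB _ _ _ (nbhs v) _ (cst w) id w v); first exact: cvg_cst.
    exact: cvg_id.
  exact: continuous_dotprod.
have [p /[!inE] Cp pmin] := compact_EVT_min C0 cC (continuous_subspaceT cf).
exists (w - p) => v Cv.
have d0 : 0 < dotprod (w - p) (w - p).
  by apply: dotprod_gt0; rewrite subr_eq0; apply/eqP => wp; apply: Cw; rewrite wp.
(* An obtuse angle at [p] suffices, because [v - w = (v - p) - (w - p)] and
   [dotprod (w - p) (w - p)] is positive. *)
suff : dotprod (v - p) (w - p) <= 0.
  rewrite -subr_lt0 -dotprodBl => vp0.
  have -> : v - w = (v - p) - (w - p) by rewrite opprB addrA subrK.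
  by rewrite dotprodBl; lra.
set q := dotprod (v - p) (w - p); set N := dotprod (v - p) (v - p).
have N0 : 0 <= N by apply: sumr_ge0 => i _; rewrite -expr2 sqr_ge0.
rewrite leNgt; apply/negP => q0.
have den0 : 0 < N + 1 + q by lra.
(* Moving from [p] towards [v] by [t] changes the squared distance to [w] by [t * (t * N - 2 * q)],
   so minimality gives [2 * q <= t * N]. This [t] lies in the unit interval and has [t * N <= q],
   which contradicts [0 < q]. *)
pose t := q / (N + 1 + q).
have t0 : 0 <= t by rewrite divr_ge0// ltW.
have t1 : t <= 1 by rewrite ler_pdivrMr//; lra.
have tgt0 : 0 < t by rewrite divr_gt0.
have := convC _ _ (Itv01 t0 t1) (mem_set Cv) (mem_set Cp).
rewrite lmod_convE/= => /pmin.
have -> : w - (t *: v + (1 - t) *: p) = (w - p) - t *: (v - p).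
  by apply/rowP => i; rewrite !mxE; ring.
rewrite !(dotprodBl (w - p)) !(dotprodBr _ (w - p)) !dotprodZr !dotprodZl.
rewrite -/N (dotprodC (w - p) (v - p)) -/q => h.
have {}h : t * (2 * q) <= t * (t * N) by lra.
rewrite ler_pM2l// in h.
have : t * N <= q.
  rewrite /t mulrAC ler_pdivrMr//; apply: ler_wpM2l; lra.
by lra.
Qed.

End DotProduct.

(** * Derivatives along lines, the mean value theorem, and balls of the sup norm *)

Section LineDerivative.
Context {R : realType} {n : nat}.
Variables (g : 'rV[R]_n -> R).
Implicit Types a b d : 'rV[R]_n.

Lemma derive_dotprod a d : differentiable g a -> 'D_d g a = dotprod (gradient g a) d.
Proof.
move=> dg; rewrite deriveE// [in LHS](row_sum_delta d) linear_sum.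
by apply: eq_bigr => i _; rewrite linearZ/= mxE deriveE// mulrC.
Qed.

Lemma is_derive_line b d (r : R) : differentiable g (b + r *: d) ->
  is_derive r 1 (fun s : R => g (b + s *: d)) (dotprod (gradient g (b + r *: d)) d).
Proof.
move=> dg; rewrite -derive_dotprod// deriveE//.
have dl : is_diff r (cst b + ( *:%R ^~ d)) (0 + ( *:%R ^~ d)) by apply: is_diffD.
have dgr : is_diff ((cst b + ( *:%R ^~ d)) r) g ('d g (b + r *: d)).
  exact: differentiableP.
have := is_diff_comp dl dgr.
rewrite -[g \o _]/(fun s : R => g (b + s *: d)) => dcomp.
split; first exact/diff_derivable/ex_diff.
rewrite deriveE; last exact: ex_diff.
by rewrite diff_val/= fctE/= add0r scale1r.
Qed.

Lemma mvt_line b d (s : R) : 0 <= s ->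
  (forall r : R, 0 <= r <= s -> differentiable g (b + r *: d)) ->
  exists2 r : R, 0 <= r <= s &
    g (b + s *: d) - g b = s * dotprod (gradient g (b + r *: d)) d.
Proof.
move=> s0 dg.
have [||r rs] := @MVT_segment R (fun r => g (b + r *: d))
    (fun r => dotprod (gradient g (b + r *: d)) d) 0 s s0.
  by move=> r; rewrite in_itv/= => /andP[r0 rs]; apply/is_derive_line/dg; rewrite !ltW.
  apply: derivable_within_continuous => r; rewrite in_itv/= => rs.
  by have [] := is_derive_line (dg r rs).
rewrite scale0r addr0 subr0 mulrC => ->; exists r => //.
Qed.

End LineDerivative.

Lemma nbhs_distP (R : realType) n (a : 'rV[R]_n) (P : 'rV[R]_n -> Prop) :
  (\forall b \near a, P b) <-> exists2 r, 0 < r & forall b, `|b - a| < r -> P b.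
Proof.
split=> [/nbhs_ballP[r r0 rP]|[r r0 rP]].
  exists r => // b br; apply: rP.
  by rewrite -ball_normE/= distrC.
apply/nbhs_ballP; exists r => // b.
by rewrite -ball_normE/= distrC; exact: rP.
Qed.

Lemma norm_line_lt (R : realType) n (a b d : 'rV[R]_n) (s u v : R) :
  `|b - a| < u -> 0 <= s -> s * `|d| < v -> `|b + s *: d - a| < u + v.
Proof.
move=> bu s0 sv; rewrite addrAC (le_lt_trans (ler_normD _ _))//.
by rewrite normrZ ger0_norm// ltrD.
Qed.

(** * Danskin's theorem for a compact family [G z], with [z] in [K], and its value function [V] *)

Section Danskin.
Context {R : realType} {m n : nat}.
Variables (G : 'rV[R]_m -> 'rV[R]_n -> R) (V : 'rV[R]_n -> R).
Variables (K : set 'rV[R]_m) (O : set 'rV[R]_n) (a : 'rV[R]_n).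
Hypothesis K_compact : compact K.
Hypothesis O_open : open O.
Hypothesis Oa : O a.
Hypothesis G_cont : continuous (fun z => G z a).
Hypothesis G_diff : forall z t, K z -> O t -> differentiable (G z) t.
Hypothesis G_grad_cont :
  {within K `*` O, continuous (fun p => gradient (G p.1) p.2)}.
(** With [V_attained], this says that [V] is the minimum over [K] on [O]. No infimum over [K] is
    written, so that [V] can be the optimal cost over the larger set [Z]. *)
Hypothesis V_le : forall z t, K z -> O t -> V t <= G z t.
Hypothesis V_attained : forall t, O t -> exists2 z, K z & V t = G z t.

Let grad z := gradient (G z) a.
Let minimizers : set 'rV[R]_m := [set z | K z /\ G z a = V a].

(** Continuity within [K] times [O], unfolded at [(z, a)]: as [O] is open, it is absorbed into the
    neighborhood of [a], and only [K z'] stays as a premise. *)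
Lemma gradient_near z : K z -> forall W : set 'rV[R]_n, nbhs (grad z) W ->
  \forall z' \near z & t \near a, K z' -> W (gradient (G z') t).
Proof.
move=> Kz W nW.
have /subspace_continuousP/(_ (z, a) (conj Kz Oa) W nW) := G_grad_cont.
move=> [[A B] /= [nA nB] AB]; exists (A, B `&` O).
  by split => //=; apply: filterI => //; exact: open_nbhs_nbhs.
by move=> [z' t] /= [Az' [Bt Ot]] Kz'; exact: (AB (z', t)).
Qed.

Lemma gradient_dotprod_near z d c : K z -> dotprod (grad z) d < c ->
  \forall z' \near z & t \near a, K z' -> dotprod (gradient (G z') t) d < c.
Proof.
move=> Kz zc; apply: (@gradient_near z Kz [set w | dotprod w d < c]).
exact: (@continuous_dotprodl _ _ d (grad z) _ (lt_nbhsl zc)).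
Qed.

(** Near each [z] of [K] the bound [|grad z| + 1] works; compactness, used as a near-covering
    property, makes the radius and the bound uniform in [z]. *)
Lemma gradient_locally_bounded : exists r M, [/\ 0 < r, 0 <= M,
  forall t, `|t - a| < r -> O t &
  forall z t, K z -> `|t - a| < r -> `|gradient (G z) t| <= M].
Proof.
(* The bound is a second parameter tending to infinity, so the near-covering property chooses it
   together with the neighborhood of [a]. *)
pose P (p : 'rV[R]_n * R) z := `|gradient (G z) p.1| <= p.2.
have := (near_covering_withinP K).2 ((compact_near_coveringP K).1 K_compact)
  _ (filter_prod (nbhs a) (pinfty_nbhs R)) P _.
case.
  move=> z Kz.
  have nW : nbhs (grad z) [set w | `|w| < `|grad z| + 1].
    have lt1 : `|grad z| < `|grad z| + 1 by rewrite ltrDl.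
    exact: (@norm_continuous _ _ (grad z) _ (lt_nbhsl lt1)).
  have [[A B] /= [nA nB] AB] := gradient_near Kz nW.
  exists (A, B `*` [set M | `|grad z| + 1 <= M]) => /=.
    split => //; exists (B, [set M | `|grad z| + 1 <= M]) => //=; split => //.
    by apply: nbhs_pinfty_ge; exact: num_real.
  move=> [z' [t M]] /= [Az' [Bt hM]] Kz'.
  by rewrite /P/= (le_trans _ hM)// ltW//; exact: (AB (z', t)).
move=> [A B] /= [nA nB] AB.
have [M [BM M0]] : exists M, B M /\ 0 <= M.
  apply: (@filter_ex _ (pinfty_nbhs R)).
  by apply: filterI => //; apply: nbhs_pinfty_ge; exact: num_real.
have /nbhs_distP[r r0 rP] : \forall t \near a, A t /\ O t.
  by apply: filterI => //; exact: open_nbhs_nbhs.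
exists r, M; split => // [t /rP[]//|z t Kz /rP[At _]].
exact: (AB (t, M)).
Qed.

Lemma cost_locally_lipschitz : exists r M, [/\ 0 < r, 0 <= M,
  forall t, `|t - a| < r -> O t &
  forall z t1 t2, K z -> `|t1 - a| < r -> `|t2 - a| < r ->
    `|G z t1 - G z t2| <= M * `|t1 - t2|].
Proof.
have [r [M [r0 M0 rO rM]]] := gradient_locally_bounded.
exists r, (n%:R * M); split => //; first by rewrite mulr_ge0.
move=> z t1 t2 Kz t1a t2a.
have inr s : 0 <= s <= 1 -> `|t2 + s *: (t1 - t2) - a| < r.
  move=> /andP[s0 s1].
  have -> : t2 + s *: (t1 - t2) - a = (1 - s) *: (t2 - a) + s *: (t1 - a).
    by apply/rowP => i; rewrite !mxE; ring.
  rewrite (le_lt_trans (ler_normD _ _))// !normrZ !ger0_norm ?subr_ge0//.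
  (* The strict inequality below comes from the term with factor [s], so [s = 0] is treated
     apart. *)
  have [->|sn0] := eqVneq s 0; first by rewrite subr0 mul0r addr0 mul1r.
  have -> : r = (1 - s) * r + s * r by ring.
  apply: ler_ltD; first by rewrite ler_wpM2l ?subr_ge0// ltW.
  by rewrite ltr_pM2l// lt0r sn0.
have [|s s01] := @mvt_line _ _ (G z) t2 (t1 - t2) 1 ler01.
  by move=> s s01; apply: G_diff => //; exact/rO/inr.
rewrite scale1r mul1r (addrC t2) subrK => ->.
rewrite (le_trans (dotprod_le_norm _ _))// ler_wpM2r// ler_wpM2l//.
by apply: rM => //; exact: inr.
Qed.

(** A minimum of uniformly Lipschitz functions is Lipschitz: a minimizer at [t2] is tested at [t1],
    and the roles are then exchanged. *)
Lemma value_locally_lipschitz : exists r M, [/\ 0 < r, 0 <= M,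
  forall t, `|t - a| < r -> O t &
  forall t1 t2, `|t1 - a| < r -> `|t2 - a| < r ->
    `|V t1 - V t2| <= M * `|t1 - t2|].
Proof.
have [r [M [r0 M0 rO rM]]] := cost_locally_lipschitz.
exists r, M; split => //.
suff lip t1 t2 : `|t1 - a| < r -> `|t2 - a| < r -> V t1 - V t2 <= M * `|t1 - t2|.
  by move=> t1 t2 h1 h2; rewrite ler_norml lerNl opprB lip// distrC lip.
move=> t1a t2a; have [z Kz ->] := V_attained (rO _ t2a).
rewrite (le_trans _ (rM z t1 t2 Kz t1a t2a))// (le_trans _ (ler_norm _))//.
by rewrite lerD2r V_le//; exact: rO.
Qed.

Lemma minimizers_compact : compact minimizers.
Proof.
rewrite (_ : minimizers = K `&` (fun z => G z a) @^-1` [set V a]).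
  apply: compact_closedI => //; apply: preimage_closed; last exact: closed_eq.
  by move=> z _; exact: G_cont.
by [].
Qed.

Lemma minimizers_nonempty : minimizers !=set0.
Proof. by have [z Kz Vz] := V_attained Oa; exists z. Qed.

Lemma gradient_within : {within minimizers, continuous grad}.
Proof.
apply/subspace_continuousP => z [Kz _] W nW.
have [[A B] /= [nA nB] AB] := gradient_near Kz nW.
apply: filterS nA => z' Az' [Kz' _].
by apply: (AB (z', a)) => //; split => //=; exact: nbhs_singleton.
Qed.

(* Upper semicontinuity of the minimizers, in the only form needed: near [a],
   a minimizer at [b] has a gradient at [t] almost as good as one at [a]. *)
Lemma gradient_dotprod_minimizers d c :
  (forall z, minimizers z -> dotprod (grad z) d < c) ->
  exists2 r, 0 < r & forall b t z, `|b - a| < r -> `|t - a| < r -> K z ->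
    V b = G z b -> dotprod (gradient (G z) t) d < c.
Proof.
move=> min_c.
pose P (p : 'rV[R]_n * 'rV[R]_n) z :=
  V p.1 = G z p.1 -> dotprod (gradient (G z) p.2) d < c.
have := (near_covering_withinP K).2 ((compact_near_coveringP K).1 K_compact)
  _ (filter_prod (nbhs a) (nbhs a)) P _.
case.
  (* Near a minimizer at [a] the bound follows from continuity of the gradient; near any other [z]
     the premise [V b = G z' b] fails. *)
  move=> z Kz; have [GV|GV] := eqVneq (G z a) (V a).
    have [[A B] /= [nA nB] AB] := gradient_dotprod_near Kz (min_c z (conj Kz GV)).
    exists (A, [set p | B p.2]) => /=; first by split => //; exact: cvg_snd.
    by move=> [z' [b t]] /= [Az' Bt] Kz' _; exact: (AB (z', t)).
  have [r [M [r0 M0 rO rM]]] := cost_locally_lipschitz.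
  have [r' [M' [r'0 M'0 _ rM']]] := value_locally_lipschitz.
  (* The gap at [z] is [3 * e]. Replacing [z] by [z'] costs less than [e], and moving from [a] to
     [b] costs less than [e] for [G] and [V] together, so a positive gap remains. *)
  pose e := (G z a - V a) / 3.
  have e0 : 0 < e by rewrite divr_gt0// subr_gt0 lt_neqAle eq_sym GV V_le.
  have nA : nbhs z [set z' | G z a - e < G z' a].
    have lte : G z a - e < G z a by rewrite ltrBlDr ltrDl.
    exact: (@G_cont z _ (lt_nbhsr lte)).
  pose rho := Num.min (Num.min r r') (e / (M + M' + 1)).
  have MM0 : 0 < M + M' + 1 by rewrite ltr_wpDl// addr_ge0.
  have rho0 : 0 < rho by rewrite !lt_min r0 r'0 divr_gt0.
  have nB : nbhs a [set b | `|b - a| < rho] by apply/nbhs_distP; exists rho.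
  exists ([set z' | G z a - e < G z' a], [set p | `|p.1 - a| < rho]) => /=.
    by split => //; exact: (@cvg_fst _ _ (nbhs a) (nbhs a) _ _ nB).
  move=> [z' [b t]] /= [Gz']; rewrite !lt_min => /andP[/andP[br br']].
  rewrite ltr_pdivlMr// => bM Kz' Vb; exfalso.
  have aa s : 0 < s -> `|a - a| < s by rewrite subrr normr0.
  have := rM z' b a Kz' br (aa _ r0); have := rM' b a br' (aa _ r'0).
  rewrite !ler_norml Vb => /andP[_ h1] /andP[h2 _].
  have ab0 : 0 <= `|b - a| by [].
  by move: bM Gz' h1 h2; rewrite /e; nra.
move=> [A B] /= [/nbhs_distP[r1 r10 r1A] /nbhs_distP[r2 r20 r2B]] AB.
exists (Num.min r1 r2); first by rewrite lt_min r10.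
move=> b t z; rewrite !lt_min => /andP[b1 _] /andP[_ t2] Kz Vb.
by apply: (AB (b, t)) Vb => //; split => /=; [exact: r1A|exact: r2B].
Qed.

(** A minimizer [z] at the base point [b] gives [V b = G z b] and [V <= G z] at the endpoint. The
    bound is uniform in [b], as the Clarke derivative requires. *)
Lemma value_quotient_lt d c :
  (forall z, minimizers z -> dotprod (grad z) d < c) ->
  exists2 r, 0 < r & forall b (s : R), `|b - a| < r -> 0 < s -> s < r ->
    (V (b + s *: d) - V b) / s < c.
Proof.
move=> min_c; have [r1 r10 r1P] := gradient_dotprod_minimizers min_c.
have [r2 [M [r20 _ r2O _]]] := value_locally_lipschitz.
(* One half is for the distance from [b] to [a], the other for the step along [d]; the [+ 1] in [q]
   covers [d = 0]. *)
pose r := Num.min r1 r2 / 2.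
have r0 : 0 < r by rewrite divr_gt0// lt_min r10.
have r2r : r + r = Num.min r1 r2 by rewrite /r; lra.
pose q := r / (`|d| + 1).
have d1 : 0 < `|d| + 1 by rewrite ltr_wpDl.
have q0 : 0 < q by rewrite divr_gt0.
exists (Num.min r q); first by rewrite lt_min r0.
move=> b s; rewrite lt_min => /andP[br _] s0; rewrite lt_min => /andP[_ sq].
have line u : 0 <= u <= s -> `|b + u *: d - a| < Num.min r1 r2.
  move=> /andP[u0 us]; rewrite -r2r; apply: norm_line_lt => //.
  have : u < q by exact: le_lt_trans us sq.
  rewrite ltr_pdivlMr// mulrDr mulr1; apply: le_lt_trans.
  by rewrite lerDl.
have lineO u : 0 <= u <= s -> O (b + u *: d).
  by move=> /line; rewrite lt_min => /andP[_ /r2O].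
have b12 : `|b - a| < Num.min r1 r2.
  by have := line 0; rewrite scale0r addr0 lexx ltW// => /(_ isT).
have Ob : O b by apply: r2O; move: b12; rewrite lt_min => /andP[].
have [z Kz Vb] := V_attained Ob.
have [|u us Guz] := @mvt_line _ _ (G z) b d s (ltW s0).
  by move=> u us; apply: G_diff => //; exact: lineO.
rewrite ltr_pdivrMr//.
apply: (@le_lt_trans _ _ (G z (b + s *: d) - G z b)).
  by rewrite Vb lerD2r V_le//; apply: lineO; rewrite lexx ltW.
rewrite Guz mulrC ltr_pM2r//; apply: (r1P b) => //.
  by move: b12; rewrite lt_min => /andP[].
by have := line u us; rewrite lt_min => /andP[].
Qed.

(** With the base point fixed at [a], a bound for a single minimizer suffices, whereas
    [value_quotient_lt] needs it for all of them. *)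
Lemma minimizer_quotient_lt z d c : minimizers z -> dotprod (grad z) d < c ->
  \forall s \near 0^'+, (V (a + s *: d) - V a) / s < c.
Proof.
move=> [Kz GV] zc.
have [[A B] /= [nA /nbhs_distP[r r0 rB]] AB] := gradient_dotprod_near Kz zc.
have [r2 [M [r20 _ r2O _]]] := value_locally_lipschitz.
have d1 : 0 < `|d| + 1 by rewrite ltr_wpDl.
have q0 : 0 < Num.min r r2 / (`|d| + 1) by rewrite divr_gt0// lt_min r0.
near=> s.
have s0 : 0 < s by near: s; exact: nbhs_right_gt.
have line u : 0 <= u <= s -> `|a + u *: d - a| < Num.min r r2.
  move=> /andP[u0 us]; rewrite addrAC subrr add0r normrZ ger0_norm//.
  have : u < Num.min r r2 / (`|d| + 1).
    by apply: le_lt_trans us _; near: s; exact: nbhs_right_lt.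
  by rewrite ltr_pdivlMr// mulrDr mulr1; apply: le_lt_trans; rewrite lerDl.
have lineO u : 0 <= u <= s -> O (a + u *: d).
  by move=> /line; rewrite lt_min => /andP[_ /r2O].
have [|u us Guz] := @mvt_line _ _ (G z) a d s (ltW s0).
  by move=> u us; apply: G_diff => //; exact: lineO.
rewrite ltr_pdivrMr//.
apply: (@le_lt_trans _ _ (G z (a + s *: d) - G z a)).
  by rewrite GV lerD2r V_le//; apply: lineO; rewrite lexx ltW.
rewrite Guz mulrC ltr_pM2r//; apply: (AB (z, a + u *: d)) => //; split => /=.
  exact: nbhs_singleton.
by apply: rB; have := line u us; rewrite lt_min => /andP[].
Unshelve. all: by end_near. Qed.

Lemma value_dirderiv d : exists2 l, is_dirderiv V a d l &
  is_minimum [set dotprod (grad z) d | z in minimizers] l.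
Proof.
have cf : {within minimizers, continuous (fun z => dotprod (grad z) d)}.
  move=> z W nW.
  exact: (gradient_within (@continuous_dotprodl _ _ d (grad z) W nW)).
have [z /[!inE] mz zmin] :=
  compact_EVT_min minimizers_nonempty minimizers_compact cf.
exists (dotprod (grad z) d); last first.
  by split; [exists z|move=> _ [z' mz' <-]; exact/zmin/mem_set].
apply/cvgrPdist_le => e e0.
have up : \forall s \near 0^'+, (V (a + s *: d) - V a) / s < dotprod (grad z) d + e.
  by apply: (minimizer_quotient_lt mz); rewrite ltrDl.
(* The lower bound: stepping by [- d] from the base point [a + s *: d] leads back to [a], so the
   uniform upper bound there turns into a lower bound in direction [d]. *)
have [|r r0 rP] := @value_quotient_lt (- d) (- dotprod (grad z) d + e).
  move=> z' mz'; rewrite dotprodNr (le_lt_trans (_ : _ <= - dotprod (grad z) d))//.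
    by rewrite lerN2; exact/zmin/mem_set.
  by rewrite ltrDl.
have d1 : 0 < `|d| + 1 by rewrite ltr_wpDl.
have q0 : 0 < r / (`|d| + 1) by rewrite divr_gt0.
near=> s.
have s0 : 0 < s by near: s; exact: nbhs_right_gt.
have hup : (V (a + s *: d) - V a) / s < dotprod (grad z) d + e by near: s.
have := rP (a + s *: d) s _ s0 _; rewrite scalerN addrK.
have -> : (V a - V (a + s *: d)) / s = - ((V (a + s *: d) - V a) / s).
  by rewrite -mulNr opprB.
move=> hlow; rewrite ler_distlC; apply/andP; split; last exact: ltW.
rewrite lerBlDr -subr_ge0.
suff : - ((V (a + s *: d) - V a) / s) < - dotprod (grad z) d + e by lra.
apply: hlow; last by near: s; exact: nbhs_right_lt.
rewrite addrAC subrr add0r normrZ gtr0_norm//.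
have : s < r / (`|d| + 1) by near: s; exact: nbhs_right_lt.
by rewrite ltr_pdivlMr// mulrDr mulr1; apply: le_lt_trans; rewrite lerDl ltW.
Unshelve. all: by end_near. Qed.

(** The limsup is an infimum of suprema over members of the filter, so one member [W] on which the
    quotients stay below [c] is enough. *)
Lemma clarke_dirderiv_le d c :
  (forall z, minimizers z -> dotprod (grad z) d < c) ->
  (clarke_dirderiv V a d <= c%:E)%E.
Proof.
move=> min_c.
have [r r0 rP] := value_quotient_lt min_c.
pose W : set ('rV[R]_n * R) := [set b | `|b - a| < r] `*` [set s | 0 < s < r].
apply: (@le_trans _ _ (ereal_sup
    ((fun p : 'rV[R]_n * R => ((V (p.1 + p.2 *: d) - V p.1) / p.2)%:E) @` W))).
  apply: ereal_inf_lbound; exists W => //.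
  exists ([set b | `|b - a| < r], [set s | 0 < s < r]) => //=; split => /=.
    by apply/nbhs_distP; exists r.
  near=> s; apply/andP; split; near: s; [exact: nbhs_right_gt|exact: nbhs_right_lt].
apply: ge_ereal_sup => _ [[b s] /= [br /andP[s0 sr]] <-].
by rewrite lee_fin ltW// rP.
Unshelve. all: by end_near. Qed.

(* The quotients based at [a - s d] bound the limsup below: [V <= G z] there,
   with equality at [a]. *)
Lemma clarke_dirderiv_ge z d : minimizers z ->
  ((dotprod (grad z) d)%:E <= clarke_dirderiv V a d)%E.
Proof.
move=> mz; apply/lee_subgt0Pr => e e0; rewrite -EFinB.
have q : \forall s \near 0^'+,
    (V (a + s *: - d) - V a) / s < - (dotprod (grad z) d - e).
  apply: (minimizer_quotient_lt mz).
  by rewrite dotprodNr ltrN2 ltrBlDr ltrDl.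
apply: le_ereal_inf_tmp => _ [W [[A B] /= [/nbhs_distP[r r0 rA] nB] AB] <-].
have d1 : 0 < `|d| + 1 by rewrite ltr_wpDl.
have q0 : 0 < r / (`|d| + 1) by rewrite divr_gt0.
have [s [s0 sq sB sr]] : exists s : R, [/\ 0 < s,
    (V (a + s *: - d) - V a) / s < - (dotprod (grad z) d - e), B s &
    s < r / (`|d| + 1)].
  apply: (@filter_ex _ (0 : R)^'+); near=> s; split; near: s => //.
    exact: nbhs_right_gt.
  exact: nbhs_right_lt.
apply: le_ereal_sup_tmp.
exists ((V (a - s *: d + s *: d) - V (a - s *: d)) / s)%:E; last first.
  rewrite subrK lee_fin -lerN2 -mulNr opprB ltW//.
  by move: sq; rewrite scalerN.
exists (a - s *: d, s) => //; apply: AB; split => //=; apply: rA.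
rewrite addrAC subrr add0r normrN normrZ gtr0_norm//.
by move: sr; rewrite ltr_pdivlMr// mulrDr mulr1; apply: le_lt_trans; rewrite lerDl ltW.
Unshelve. all: by end_near. Qed.

(** For each [d] the mixture is compared with the larger of the two dot products, which avoids
    arithmetic with a possibly infinite [clarke_dirderiv]. *)
Lemma convex_clarke_subdiff :
  convex_set (clarke_subdiff V a : set (convex_lmodType _)).
Proof.
move=> u v l /[!inE] Vu Vv d; rewrite lmod_convE dotprodDl !dotprodZl.
have l1 : 0 <= 1 - l%:num by rewrite subr_ge0.
have [uv|vu] := leP (dotprod u d) (dotprod v d).
  apply: le_trans (Vv d); rewrite lee_fin.
  rewrite [leRHS](_ : _ = l%:num * dotprod v d + (1 - l%:num) * dotprod v d); last by ring.
  by rewrite lerD2r ler_wpM2l.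
apply: le_trans (Vu d); rewrite lee_fin.
rewrite [leRHS](_ : _ = l%:num * dotprod u d + (1 - l%:num) * dotprod u d); last by ring.
by rewrite lerD2l ler_wpM2l// ltW.
Qed.

Lemma clarke_subdiff_value :
  clarke_subdiff V a = convex_hull [set grad z | z in minimizers].
Proof.
rewrite eqEsubset; split => [w Vw|]; last first.
  apply: smallest_sub; first exact: convex_clarke_subdiff.
  by move=> _ [z mz <-] d; exact: clarke_dirderiv_ge.
apply: contrapT => hullw.
set H := convex_hull _ in hullw.
have subH : [set grad z | z in minimizers] `<=` H by exact: sub_smallest.
have convH : convex_set (H : set (convex_lmodType _)).
  by rewrite /H convex_hullE; exact: convex_combinations_convex.
have cH : compact H.
  apply: convex_hull_compact; apply: continuous_compact.
    exact: gradient_within.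
  exact: minimizers_compact.
have H0 : H !=set0.
  have [z mz] := minimizers_nonempty.
  by exists (grad z); apply: subH; exists z.
have [d wd] := strict_separation convH cH H0 hullw.
have [p /[!inE] Hp pmax] :=
  compact_EVT_max H0 cH (continuous_subspaceT (@continuous_dotprodl _ _ d)).
have pw := wd p Hp.
have := Vw d; rewrite leNgt => /negP; apply.
(* The midpoint lies strictly above the maximum over the hull, as [clarke_dirderiv_le] demands, and
   strictly below [dotprod w d]. *)
apply: (@le_lt_trans _ _ (((dotprod p d + dotprod w d) / 2)%:E)); last first.
  by rewrite lte_fin; lra.
apply: clarke_dirderiv_le => z mz.
have := pmax (grad z) (mem_set (subH _ (ex_intro2 _ _ z mz erefl))).
by lra.
Qed.

End Danskin.

(** * Local Lipschitz continuity of integrals depending on a parameter *)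

Lemma locally_lipschitz_aroundI (R : realType) n (g : 'rV[R]_n -> R) a (r k : R) :
  0 < r -> (forall t1 t2, `|t1 - a| < r -> `|t2 - a| < r ->
    `|g t1 - g t2| <= k * `|t1 - t2|) -> locally_lipschitz_around g a.
Proof.
move=> r0 lip; exists [set t | `|t - a| < r]; first by apply/nbhs_distP; exists r.
(* [lipschitz] asks for the bound with all large enough constants; [k] is the threshold. *)
exists k; split; first exact: num_real.
move=> M kM [t1 t2] [/= t1r t2r].
by rewrite (le_trans (lip _ _ t1r t2r))// ler_wpM2r// ltW.
Qed.

Lemma continuous_borel_measurable (R : realType) n (g : 'rV[R]_n -> R) :
  continuous g -> measurable_fun setT (g : borel_rV R n -> R).
Proof.
move=> /continuousP cg; apply: (measurability _ (RGenOpens.measurableE R)).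
move=> _ [_ [u [v ->] <-]]; rewrite setTI; apply: sub_sigma_algebra.
exact/cg/interval_open.
Qed.

Section ParameterIntegral.
Context {R : realType} {dy dt : nat}.
Variables (nu : {measure set (borel_rV R dy) -> \bar R}).
Variables (l : 'rV[R]_dy -> 'rV[R]_dt -> R) (a : 'rV[R]_dt).
Hypothesis l_cont : forall t, continuous (l ^~ t).
Hypothesis l_int : nu.-integrable setT (fun y : borel_rV R dy => (l y a)%:E).

(** The increments of [l] are dominated by [|k|] times the distance, so its integral is a Lipschitz
    constant. Integrability, assumed at [a] only, spreads to nearby [t] by adding an increment to
    [l y a]. *)
Lemma integral_locally_lipschitz : integrably_lipschitz_around nu l a ->
  exists r k, [/\ 0 < r, 0 <= k,
    forall t, `|t - a| < r ->
      nu.-integrable setT (fun y : borel_rV R dy => (l y t)%:E) &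
    forall t1 t2, `|t1 - a| < r -> `|t2 - a| < r ->
      `|\int[nu]_y l y t1 - \int[nu]_y l y t2| <= k * `|t1 - t2|].
Proof.
move=> [U [k [nU ik lipk]]].
have /nbhs_distP[r r0 rU] : \forall t \near a, U t by [].
have ink : nu.-integrable setT (fun y : borel_rV R dy => `|k y|%:E).
  exact: (@integrable_norm _ (borel_rV R dy) _ nu setT k ik).
have ml t : measurable_fun setT (fun y : borel_rV R dy => l y t).
  exact: continuous_borel_measurable.
have mk : measurable_fun setT (k : borel_rV R dy -> R).
  by case/integrableP : ik => /measurable_EFinP.
have mnk : measurable_fun setT (fun y : borel_rV R dy => `|k y|).
  exact: measurableT_comp.
have le_int t1 t2 : `|t1 - a| < r -> `|t2 - a| < r ->
    (\int[nu]_y `|(l y t1 - l y t2)%:E| <= \int[nu]_y (`|t1 - t2| * `|k y|)%:E)%E.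
  move=> /rU t1U /rU t2U; apply: ae_ge0_le_integral => //.
  - by apply: measurableT_comp => //; apply/measurable_EFinP; exact: measurable_funB.
  - apply/measurable_EFinP; apply: measurable_funM => //.
  apply: filterS lipk => y lipy _; rewrite lee_fin.
  by rewrite (le_trans (lipy _ _ t1U t2U))// mulrC ler_wpM2l// ler_norm.
have dint t1 t2 : `|t1 - a| < r -> `|t2 - a| < r ->
    nu.-integrable setT (fun y : borel_rV R dy => (l y t1 - l y t2)%:E).
  move=> t1a t2a; apply/integrableP; split.
    by apply/measurable_EFinP; exact: measurable_funB.
  apply: le_lt_trans (le_int _ _ t1a t2a) _.
  under eq_integral do rewrite EFinM.
  have /integrableP[_] := integrableZl measurableT `|t1 - t2| ink.
  apply: le_lt_trans; apply: ge0_le_integral => //.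
  - by apply: measurable_funeM; exact/measurable_EFinP.
  - by apply: measurableT_comp => //; apply: measurable_funeM; exact/measurable_EFinP.
  - by move=> y _; rewrite lee_abs.
have lint t : `|t - a| < r ->
    nu.-integrable setT (fun y : borel_rV R dy => (l y t)%:E).
  move=> ta.
  have aa : `|a - a| < r by rewrite subrr normr0.
  have := integrableD measurableT (dint _ _ ta aa) l_int.
  by apply: eq_integrable => // y _ /=; rewrite -EFinD subrK.
exists r, (\int[nu]_y `|k y|); split => //.
  by apply: fine_ge0; apply: integral_ge0 => y _; rewrite lee_fin.
move=> t1 t2 t1a t2a.
rewrite -RintegralB//; [|exact: lint..].
rewrite (le_trans (le_normr_Rintegral _ _))//; first exact: dint.
rewrite mulrC -RintegralZl// fine_le//.
- apply: integrable_fin_num => //.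
  exact: (@integrable_norm _ (borel_rV R dy) _ nu setT
    (fun y => l y t1 - l y t2) (dint _ _ t1a t2a)).
- by apply: integrable_fin_num => //; exact: (integrableZl measurableT `|t1 - t2| ink).
- exact: le_int.
Qed.

End ParameterIntegral.

(** * Application to the optimal cost and to the penalized loss *)

Theorem proposition4p3 (R : realType) (dx dy dz dt : nat)
  (disp : measure_display) (Omega : measurableType disp)
  (Pr : probability Omega R)
  (X : {RV Pr >-> borel_rV R dx}) (Y : {RV Pr >-> borel_rV R dy})
  (kappa : R.-pker (borel_rV R dx) ~> (borel_rV R dy))
  (kappaP : is_conditional_law X Y kappa)
  (Theta : set 'rV[R]_dt) (Z : set 'rV[R]_dz)
  (L : 'rV[R]_dz -> 'rV[R]_dx -> 'rV[R]_dy -> 'rV[R]_dt -> R)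
  (c : 'rV[R]_dz -> 'rV[R]_dy -> R)
  (f : 'rV[R]_dt -> 'rV[R]_dx -> probability (borel_rV R dy) R)
  (mu : 'rV[R]_dx -> R)
  (XX := law_support (distribution Pr X))
  (L_cont : continuous (fun q : 'rV[R]_dz * 'rV[R]_dx * 'rV[R]_dy * 'rV[R]_dt =>
                          L q.1.1.1 q.1.1.2 q.1.2 q.2))
  (c_cont : continuous (fun q : 'rV[R]_dz * 'rV[R]_dy => c q.1 q.2))
  (c_int : forall z t x, Theta t -> XX x ->
     (f t x).-integrable setT (fun y : borel_rV R dy => (c z y)%:E))
  (mu_meas : measurable_fun (XX : set (borel_rV R dx)) (mu : borel_rV R dx -> R))
  (mu_ge0 : forall x, XX x -> 0 <= mu x)
  (cost_C1_z : forall t x, Theta t -> XX x ->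
     continuously_differentiable (fun z => expected_cost c f z t x))
  (cost_diff_t : forall z t x, Z z -> Theta° t -> XX x ->
     differentiable (fun t' => expected_cost c f z t' x) t)
  (grad_cost_cont : forall x, XX x ->
     {within Z `*` Theta°, continuous (fun p => grad_cost c f p.1 p.2 x)})
  (Z_closed : closed Z) (Z_convex : convex_set Z)
  (level_bounded : exists (beta : R) (Zbeta : set 'rV[R]_dz),
     [/\ compact Zbeta, Zbeta `<=` Z &
      forall t x, Theta t -> XX x ->
        let lev := [set z | Z z /\ expected_cost c f z t x <= beta] in
        lev !=set0 /\ lev `<=` Zbeta])
  (tbar : 'rV[R]_dt) (tbar_in : Theta° tbar)
  (x : 'rV[R]_dx) (x_in : XX x) :
  let Cstar := fun t => optimal_cost c f Z t x in
  let Zstar := argmin_cost c f Z tbar x in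
  let grad := fun z => grad_cost c f z tbar x in
  [/\ (* (i) *)
      [/\ locally_lipschitz_around Cstar tbar,
          clarke_subdiff Cstar tbar = convex_hull [set grad z | z in Zstar] &
          forall d : 'rV[R]_dt, exists2 m : R,
            is_dirderiv Cstar tbar d m &
            is_minimum [set dotprod (grad z) d | z in Zstar] m],
      (* (ii) *)
      (forall w, clarke_subdiff Cstar tbar w ->
         exists (z : 'I_dt.+1 -> 'rV[R]_dz) (lambda : 'I_dt.+1 -> R),
           [/\ forall i, Zstar (z i),
               forall i, 0 <= lambda i,
               \sum_(i < dt.+1) lambda i = 1 &
               w = \sum_(i < dt.+1) lambda i *: grad (z i)]) &
      (* (iii) *)
      (forall z, Z z ->
         (kappa x).-integrable setT (fun y : borel_rV R dy => (L z x y tbar)%:E) ->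
         integrably_lipschitz_around (kappa x) (fun y t => L z x y t) tbar ->
         locally_lipschitz_around
           (fun t => conditional_expectation kappa
              (fun x' y => penalized_loss c f Z L (mu x') z x' y t) x)
           tbar)].
Proof.
move=> Cstar Zstar grad.
pose G z t := expected_cost c f z t x.
have [beta [K [K_compact KZ lev_K]]] := level_bounded.
have G_cont t : Theta t -> continuous (G ^~ t).
  move=> Tt z; apply: differentiable_continuous.
  by have [+ _] := cost_C1_z t x Tt x_in; exact.
(* The level set is closed in the compact [K], so the cost has a minimizer on it; elsewhere in [Z]
   the cost exceeds [beta], so this point minimizes over [Z] and the infimum is its value. *)
have attained t : Theta t -> exists z, [/\ K z, G z t <= beta, Cstar t = G z t &
    forall z', Z z' -> G z t <= G z' t].
  move=> Tt; have [lev0 levK] := lev_K t x Tt x_in.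
  set lev := [set z | _] in lev0 levK.
  have lev_closed : closed lev.
    apply: (closedI Z_closed).
    apply: (@preimage_closed _ _ (G ^~ t) [set y | y <= beta]); last exact: closed_le.
    by move=> z _; exact: G_cont.
  have lev_compact := subclosed_compact lev_closed K_compact levK.
  have [z /[!inE] levz zmin] :=
    compact_EVT_min lev0 lev_compact (continuous_subspaceT (G_cont t Tt)).
  have Gz_beta : G z t <= beta by case: levz.
  have zminZ z' : Z z' -> G z t <= G z' t.
    move=> Zz'; have [Gz'|/ltW Gz'] := leP (G z' t) beta.
      by apply: zmin; rewrite inE.
    exact: le_trans Gz'.
  exists z; split => //; first exact: levK.
  apply/eqP; rewrite eq_le; apply/andP; split.
    apply: ge_inf; last by exists z; [case: levz|].
    by exists (G z t) => _ [z' Zz' <-]; exact: zminZ.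
  apply: lb_le_inf; first by exists (G z t), z; [case: levz|].
  by move=> _ [z' Zz' <-]; exact: zminZ.
have O_open : open Theta° by exact: open_interior.
have OT t : Theta° t -> Theta t by exact: interior_subset.
have V_attained t : Theta° t -> exists2 z, K z & Cstar t = G z t.
  by move=> /OT/attained[z [Kz _ Cz _]]; exists z.
have V_le z t : K z -> Theta° t -> Cstar t <= G z t.
  by move=> /KZ Zz /OT/attained[z0 [_ _ -> ->]].
have G_diff z t : Z z -> Theta° t -> differentiable (G z) t.
  by move=> Zz Tt; exact: cost_diff_t.
(* Stated for any subset of [Z], to be used with [K] in (i) and with [[set z]] in (iii), where [z]
   may lie outside [K]. *)
have G_grad A : A `<=` Z ->
    {within A `*` Theta°, continuous (fun p => gradient (G p.1) p.2)}.
  move=> AZ; apply: continuous_subspaceW (grad_cost_cont x x_in).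
  by move=> [z t] [/AZ].
(* Minimizers over [Z] have the optimal value, which is at most [beta], and hence belong to [K]. *)
have ZstarE : Zstar = [set z | K z /\ G z tbar = Cstar tbar].
  have [z0 [Kz0 z0_beta Cz0 z0min]] := attained _ (OT _ tbar_in).
  have [_ levK] := lev_K tbar x (OT _ tbar_in) x_in.
  rewrite eqEsubset; split => z.
    move=> [Zz zmin]; have Gzz0 : G z tbar = G z0 tbar.
      by apply/eqP; rewrite eq_le z0min// andbT; exact/zmin/KZ.
    by split; [apply: levK; split; rewrite //= -/(G z tbar) Gzz0|rewrite Gzz0].
  by move=> [/KZ Zz Gz]; split => // z' /z0min; rewrite -/(G z tbar) Gz Cz0.
have G_diffK z t : K z -> Theta° t -> differentiable (G z) t.
  by move=> /KZ; exact: G_diff.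
have subdiffE : clarke_subdiff Cstar tbar = convex_hull [set grad z | z in Zstar].
  rewrite ZstarE; exact: (clarke_subdiff_value K_compact O_open tbar_in
    (G_cont _ (OT _ tbar_in)) G_diffK (G_grad _ KZ) V_le V_attained).
have [r1 [M1 [r10 M10 _ lipV]]] := value_locally_lipschitz K_compact O_open
  tbar_in G_diffK (G_grad _ KZ) V_le V_attained.
split.
- split => //; first exact: locally_lipschitz_aroundI lipV.
  move=> d; rewrite ZstarE; exact: (value_dirderiv K_compact O_open tbar_in
    (G_cont _ (OT _ tbar_in)) G_diffK (G_grad _ KZ) V_le V_attained d).
- move=> w; rewrite subdiffE convex_hullE => -[lam [v [lam0 lam1 Av ->]]].
  have /choice[z zP] : forall i, exists z, Zstar z /\ grad z = v i.
    by move=> i; have [z Zz <-] := Av i; exists z.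
  exists z, lam; split => //; first by move=> i; case: (zP i).
  by apply: eq_bigr => i _; rewrite (zP i).2.
- move=> z Zz Lint Llip.
  have L_cont_y t : continuous (fun y => L z x y t).
    move=> y; apply: (@continuous_comp _ _ _ (fun y => (z, x, y, t))
      (fun q : 'rV[R]_dz * 'rV[R]_dx * 'rV[R]_dy * 'rV[R]_dt =>
         L q.1.1.1 q.1.1.2 q.1.2 q.2)); last exact: L_cont.
    have zxy : (fun y' => (z, x, y')) @ y --> (z, x, y).
      exact: (@cvg_pair _ _ _ _ (nbhs (z, x)) (nbhs y) _ _ _ (fun=> (z, x)) id
        (cvg_cst _) cvg_id).
    exact: (@cvg_pair _ _ _ _ (nbhs (z, x, y)) (nbhs t) _ _ _ _ (fun=> t)
      zxy (cvg_cst _)).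
  have [r2 [M2 [r20 M20 intL lipL]]] := integral_locally_lipschitz L_cont_y Lint Llip.
  have z_sub : [set z] `<=` Z by move=> _ ->.
  have [|r3 [M3 [r30 M30 _ lipG]]] := cost_locally_lipschitz (@compact_set1 _ z) O_open
    tbar_in _ (G_grad _ z_sub).
    by move=> _ t ->; exact: G_diff.
  pose r := Num.min r1 (Num.min r2 r3).
  (* The penalty is constant in [y] and [kappa x] has mass one, so it comes out of the integral
     unchanged. *)
  have condE t : `|t - tbar| < r2 -> conditional_expectation kappa
      (fun x' y => penalized_loss c f Z L (mu x') z x' y t) x =
      \int[kappa x]_y L z x y t + mu x * (G z t - Cstar t).
    move=> tr2; rewrite /conditional_expectation /penalized_loss.
    rewrite RintegralD//; last 2 first.
    + exact: intL.
    + apply/integrableP; split; first exact/measurable_EFinP.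
      by rewrite /= integral_cst// prob_kernel mule1 ltry.
    by rewrite Rintegral_cst// prob_kernel mulr1.
  (* [M2] serves the integral of [L], [M3] the cost at [z] and [M1] the optimal cost. *)
  apply: (@locally_lipschitz_aroundI _ _ _ _ r (M2 + `|mu x| * (M3 + M1))).
    by rewrite !lt_min r10 r20.
  move=> t1 t2; rewrite !lt_min => /and3P[t1r1 t1r2 t1r3] /and3P[t2r1 t2r2 t2r3].
  rewrite !condE// opprD addrACA (le_trans (ler_normD _ _))// mulrDl lerD//.
    exact: lipL.
  rewrite -mulrBr normrM -mulrA ler_wpM2l//.
  rewrite opprB addrCA -addrA addrA [X in `|X|](_ : _ =
    (G z t1 - G z t2) - (Cstar t1 - Cstar t2)); last by ring.
  rewrite (le_trans (ler_normB _ _))// mulrDl lerD//; first exact: lipG.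
  exact: lipV.
Qed.
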